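(* In the spectrum pooling game $\mathcal G$, there is a unique Nash equilibrium if $-1<J_{ij}^{BR}<0$ for all $i,j$ with $j\neq i$.
   Context: $\mathcal G$ is an $N$-player non-cooperative game: player (operator) $i$ chooses $\beta_i\in S_i=[\beta_i^{min},\beta_i^{max}]$ and has a twice continuously differentiable utility $U_i(\beta_i,\boldsymbol\beta_{-i})$ that is concave in $\beta_i$ (understood as $\partial^2U_i/\partial\beta_i^2<0$) and depends on the opponents' strategies only through their sum $\sum_{j\ne i}\beta_j$. A Nash equilibrium is $\boldsymbol\beta'\in S_1\times\cdots\times S_N$ with $U_i(\beta_i',\boldsymbol\beta_{-i}')\ge U_i(\beta_i,\boldsymbol\beta_{-i}')$ for all $\beta_i\in S_i$ and all $i$. $BR_i(\boldsymbol\beta_{-i})=\arg\max_{\beta_i\in S_i}U_i(\beta_i,\boldsymbol\beta_{-i})$ is the best response and $J_{ij}^{BR}=\frac{\partial BR_i(\boldsymbol\beta_{-i})}{\partial\beta_j}$ ($j\ne i$) is its slope, which by implicit differentiation of the first-order condition equals $-\frac{\partial^2U_i}{\partial\beta_i\partial\beta_j}\big(\frac{\partial^2U_i}{\partial\beta_i^2}\big)^{-1}$; for fixed $i$ it is the same for all $j\neq i$. The condition on $J_{ij}^{BR}$ is required at every strategy profile. *)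

(* Defs.v *)
From HB Require Import structures.
From mathcomp Require Import all_boot all_order all_algebra.
From mathcomp Require Import all_classical all_reals all_analysis.

Set Implicit Arguments.
Unset Strict Implicit.
Unset Printing Implicit Defensive.

Import Order.TTheory GRing.Theory Num.Theory.
Import numFieldNormedType.Exports.

Local Open Scope classical_set_scope.
Local Open Scope ring_scope.

Definition upd (R : realType) (N : nat) (b : 'rV[R]_N) (i : 'I_N) (x : R) :
    'rV[R]_N :=
  \row_(k < N) (if k == i then x else b ord0 k).

Definition partial (R : realType) (N : nat) (j : 'I_N) (F : 'rV[R]_N -> R)
    (b : 'rV[R]_N) : R :=
  'D_(delta_mx ord0 j) F b.

Definition has_partial (R : realType) (N : nat) (j : 'I_N)
    (F : 'rV[R]_N -> R) (b : 'rV[R]_N) : Prop :=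
  derivable F b (delta_mx ord0 j).

Definition C2_on (R : realType) (N : nat) (O : set 'rV[R]_N)
    (F : 'rV[R]_N -> R) : Prop :=
  forall b : 'rV[R]_N, O b ->
    [/\ {for b, continuous F},
        forall j : 'I_N, has_partial j F b /\ {for b, continuous (partial j F)}
      & forall j k : 'I_N, has_partial k (partial j F) b /\
          {for b, continuous (partial k (partial j F))}].

Definition box (R : realType) (N : nat) (lo hi : 'I_N -> R) : set 'rV[R]_N :=
  [set b | forall i : 'I_N, lo i <= b ord0 i <= hi i].

(* Utilities are total functions, but only their values on the strategy box
   matter; "C^2 on the closed box" means C^2 on an open neighbourhood of it. *)
Record pooling_game (R : realType) (N : nat) := PoolingGame {
  bmin : 'I_N -> R ;
  bmax : 'I_N -> R ;
  utility : 'I_N -> 'rV[R]_N -> R ;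
  bmin_le_bmax : forall i : 'I_N, bmin i <= bmax i ;
  utility_C2 : forall i : 'I_N, exists O : set 'rV[R]_N,
    [/\ open O, box bmin bmax `<=` O & C2_on O (utility i)] ;
  utility_concave : forall (i : 'I_N) (b : 'rV[R]_N), box bmin bmax b ->
    partial i (partial i (utility i)) b < 0 ;
  utility_aggregative : forall (i : 'I_N) (b c : 'rV[R]_N),
    box bmin bmax b -> box bmin bmax c ->
    b ord0 i = c ord0 i ->
    \sum_(j < N | j != i) b ord0 j = \sum_(j < N | j != i) c ord0 j ->
    utility i b = utility i c
}.

Definition profile (R : realType) (N : nat) (G : pooling_game R N) :
    set 'rV[R]_N :=
  box (bmin G) (bmax G).

Definition nash_equilibrium (R : realType) (N : nat) (G : pooling_game R N)
    (b : 'rV[R]_N) : Prop :=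
  profile G b /\
  forall (i : 'I_N) (x : R), bmin G i <= x <= bmax G i ->
    utility G i (upd b i x) <= utility G i b.

Definition argmax_set (R : realType) (N : nat) (G : pooling_game R N)
    (i : 'I_N) (b : 'rV[R]_N) : set R :=
  [set x | bmin G i <= x <= bmax G i /\
     forall y : R, bmin G i <= y <= bmax G i ->
       utility G i (upd b i y) <= utility G i (upd b i x)].

(* At a strategy profile the argmax is a singleton (compactness and strict
   concavity), so [get] returns its only element. The i-th entry of [b] is
   irrelevant: [upd] overwrites it. *)
Definition BR (R : realType) (N : nat) (G : pooling_game R N) (i : 'I_N)
    (b : 'rV[R]_N) : R :=
  get (argmax_set G i b).

(* If the derivative does not exist, [derive1] is the limit of a divergent
   quotient, which is [point = 0] in [R]; hence [J_BR G i j b < 0] entails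
   differentiability. *)
Definition J_BR (R : realType) (N : nat) (G : pooling_game R N) (i j : 'I_N)
    (b : 'rV[R]_N) : R :=
  derive1 (fun t : R => BR G i (upd b j t)) (b ord0 j).

(* The profiles at which J_BR G i j is a two-sided derivative governed by the
   first-order condition: b_j can be moved both ways inside player j's
   interval, and player i's best response is not clamped at an endpoint (on a
   clamped stretch BR is constant and satisfies no first-order condition). *)
Definition slope_defined (R : realType) (N : nat) (G : pooling_game R N)
    (i j : 'I_N) (b : 'rV[R]_N) : Prop :=
  bmin G j < b ord0 j < bmax G j /\ bmin G i < BR G i b < bmax G i.

(* Main.v *)
(* By aggregativity and strict concavity, player i's best response is a
   single-valued continuous function r_i of the opponents' sum y. Its slope lies
   in (-1, 0) wherever it is not clamped at an endpoint, so r_i is nonincreasing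
   while y + r_i(y) is strictly increasing. Hence for each total S the equation
   x = r_i(S - x) has exactly one solution x_i(S), continuous and nonincreasing
   in S. Nash equilibria correspond to the zeros of the strictly decreasing
   continuous function sum_i x_i(S) - S, which changes sign. *)
Require Import Defs.
From HB Require Import structures.
From mathcomp Require Import all_boot all_order all_algebra.
From mathcomp Require Import all_classical all_reals all_analysis.
From mathcomp Require Import lra.

Import Order.TTheory GRing.Theory Num.Theory.
Import numFieldNormedType.Exports.

Local Open Scope classical_set_scope.
Local Open Scope ring_scope.

(** * Monotonicity from slope bounds on unclamped stretches *)

(** Take for [p] the last point of [[a, b]] at level [f a] and for [q] the first point after it at
    level [f b]; the intermediate value theorem forbids leaving the band in between. Values strictly
    between two attained ones are never clamped, so slope bounds apply on all of [(p, q)]. *)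
Lemma level_crossing (R : realType) (f : R -> R) (a b : R) :
  continuous f -> a <= b -> f a < f b ->
  exists p q : R, [/\ a <= p < q, q <= b, f p = f a, f q = f b &
    forall t, p < t < q -> f a < f t < f b].
Proof.
move=> cf ab fab.
have cpt (u v w : R) : compact (`[u, v] `&` f @^-1` [set w]).
  apply: compact_closedI; first exact: segment_compact.
  by apply: closed_comp => [x _|]; [exact: cf|exact: closed_eq].
have idc (A : set R) : {within A, continuous id}.
  by apply: continuous_subspaceT => x; exact: cvg_id.
have [p] : exists2 p, p \in `[a, b] `&` f @^-1` [set f a] &
    forall t, t \in `[a, b] `&` f @^-1` [set f a] -> t <= p.
  apply: compact_EVT_max => //; exists a; split => //=.
  by rewrite in_itv /= lexx.
rewrite inE => -[/=]; rewrite in_itv /= => /andP[ap pb] fp pmax.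
have [q] : exists2 q, q \in `[p, b] `&` f @^-1` [set f b] &
    forall t, t \in `[p, b] `&` f @^-1` [set f b] -> q <= t.
  apply: compact_EVT_min => //; exists b; split => //=.
  by rewrite in_itv /= pb lexx.
rewrite inE => -[/=]; rewrite in_itv /= => /andP[pq qb] fq qmin.
have cfw (A : set R) : {within A, continuous f} by exact: continuous_subspaceT.
have ltpq : p < q.
  by rewrite lt_neqAle pq andbT; apply: contraTneq fab => epq;
    rewrite -fp -fq epq ltxx.
exists p, q; split=> //; first by rewrite ap.
move=> t /andP[pt tq]; apply/andP; split; rewrite ltNge; apply/negP => h.
- have [|s] := IVT (v := f a) (ltW tq) (cfw _).
    by rewrite fq ge_min h le_max (ltW fab) orbT.
  rewrite in_itv /= => /andP[ts sq] fs.
  have : s <= p.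
    apply: pmax; rewrite inE; split => //=; rewrite in_itv /=.
    by rewrite (le_trans sq qb) andbT (le_trans ap)// (le_trans (ltW pt)).
  by rewrite leNgt (lt_le_trans pt ts).
- have [|s] := IVT (v := f b) (ltW pt) (cfw _).
    by rewrite fp ge_min (ltW fab) le_max h orbT.
  rewrite in_itv /= => /andP[ps st] fs.
  have : q <= s.
    apply: qmin; rewrite inE; split => //=; rewrite in_itv /=.
    by rewrite ps /= (le_trans st)// (le_trans (ltW tq)).
  by rewrite leNgt (le_lt_trans st tq).
Qed.

Lemma continuous_MVT (R : realType) (f : R -> R) (p q : R) :
  continuous f -> p < q -> (forall t, p < t < q -> derivable f t 1) ->
  exists2 t, p < t < q & f q - f p = derive1 f t * (q - p).
Proof.
move=> cf pq df.
have [x xpq||t] := @MVT _ f (derive1 f) p q pq.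
- by rewrite derive1E; apply/derivableP/df; rewrite in_itv in xpq.
- exact: continuous_subspaceT.
- by rewrite in_itv /= => tpq e; exists t.
Qed.

Section clamped_slope.
Context (R : realType) (f : R -> R) (lo hi a b : R).
Hypothesis cf : continuous f.
Hypothesis f_bnd : forall y, lo <= f y <= hi.
Hypothesis f_slope : forall y, a < y < b -> lo < f y < hi ->
  derivable f y 1 /\ -1 < derive1 f y < 0.

(** A rise from [y] to [z] would contain a crossing stretch that is unclamped throughout, and there
    the mean value theorem contradicts the negative slope. *)
Lemma clamped_slope_nonincreasing y z :
  a <= y -> y <= z -> z <= b -> f z <= f y.
Proof.
move=> ay yz zb; rewrite leNgt; apply/negP => fyz.
have [p [q [/andP[yp pq] qz fp fq fpq]]] := level_crossing _ _ _ _ cf yz fyz.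
have sl t : p < t < q -> derivable f t 1 /\ -1 < derive1 f t < 0.
  move=> /[dup] /fpq /andP[f1 f2] /andP[pt tq]; apply: f_slope.
    by rewrite (le_lt_trans ay (le_lt_trans yp pt)) (lt_le_trans tq (le_trans
      qz zb)).
  have /andP[l1 _] := f_bnd y; have /andP[_ h2] := f_bnd z.
  by rewrite (le_lt_trans l1 f1) (lt_le_trans f2 h2).
have [t /sl[]|t /sl[_ /andP[_ df0]]] := continuous_MVT _ _ _ _ cf pq;
  first by [].
rewrite fp fq => e; have : 0 < f z - f y by rewrite subr_gt0.
by rewrite e nmulr_rgt0// subr_lt0 ltNge (ltW pq).
Qed.

(** Otherwise [f] drops by at least [z - y]. Level crossing for [- f] locates the whole drop on an
    unclamped stretch of length at most [z - y], where slope above [-1] makes the drop smaller than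
    that length. *)
Lemma clamped_slope_increasing y z :
  a <= y -> y < z -> z <= b -> y + f y < z + f z.
Proof.
move=> ay yz zb; rewrite ltNge; apply/negP => fyz.
have cNf : continuous (fun x => - f x) by move=> x; exact: continuousN (cf x).
have Nfyz : - f y < - f z by lra.
have [p [q [/andP[yp pq] qz fp fq fpq]]] := level_crossing _ _ _ _ cNf (ltW yz)
  Nfyz.
have sl t : p < t < q -> derivable f t 1 /\ -1 < derive1 f t < 0.
  move=> /[dup] /fpq /andP[f1 f2] /andP[pt tq]; apply: f_slope.
    by rewrite (le_lt_trans ay (le_lt_trans yp pt)) (lt_le_trans tq (le_trans
      qz zb)).
  have /andP[l1 h1] := f_bnd y; have /andP[l2 h2] := f_bnd z.
  by apply/andP; split; lra.
have [t /sl[]|t /sl[_ /andP[df1 _]] e] := continuous_MVT _ _ _ _ cf pq;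
  first by [].
have : - (q - p) < f q - f p by rewrite e -mulN1r ltr_pM2r ?subr_gt0.
by lra.
Qed.

End clamped_slope.

(** * From reaction functions to a unique consistent total *)

(** The signs of [h] at [x S - e] and [x S + e] persist for parameters [T] near [S], and strict
    monotonicity in the first argument then traps [x T] between these points. *)
Lemma continuous_root (R : realType) (h : R -> R -> R) (x : R -> R) :
  (forall z, continuous (h z)) ->
  (forall S z w, z < w -> h z S < h w S) ->
  (forall S, h (x S) S = 0) -> continuous x.
Proof.
move=> hc hinc hx S; apply/cvgrPdist_lt => e e0.
have hlo : h (x S - e) S < 0 by rewrite -(hx S) hinc// ltrBlDr ltrDl.
have hhi : 0 < h (x S + e) S by rewrite -(hx S) hinc// ltrDl.
near=> T.
have Tlo : h (x S - e) T < 0.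
  by near: T; apply: (cvgr_lt _ (hc (x S - e) S) _ hlo).
have Thi : 0 < h (x S + e) T.
  by near: T; apply: (cvgr_gt _ (hc (x S + e) S) _ hhi).
have hle z w : z <= w -> h z T <= h w T.
  by rewrite le_eqVlt => /predU1P[->//|zw]; exact/ltW/hinc.
have below z : h z T < 0 -> z < x T.
  by apply: contraTT; rewrite -!leNgt => /hle; rewrite hx.
have above z : 0 < h z T -> x T < z.
  by apply: contraTT; rewrite -!leNgt => /hle; rewrite hx.
have := below _ Tlo; have := above _ Thi; rewrite ltr_norml => u v.
by apply/andP; split; lra.
Unshelve. all: by end_near. Qed.

Lemma replacement_function (R : realType) (r : R -> R) (lo hi : R) :
  continuous r -> (forall y, lo <= r y <= hi) ->
  (forall y z, y <= z -> r z <= r y) ->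
  (forall y z, y < z -> y + r y < z + r z) ->
  exists x : R -> R, [/\ continuous x, (forall S T, S <= T -> x T <= x S) &
    forall S z, z = r (S - z) <-> z = x S].
Proof.
move=> rc rb rdec rinc.
pose h z S := z - r (S - z).
have hcS z : continuous (h z).
  move=> S; apply: cvgB; first exact: cvg_cst.
  apply: (@continuous_comp _ _ _ (fun T => T - z) r); last exact: rc.
  by apply: cvgB; [exact: cvg_id|exact: cvg_cst].
have hcz S : continuous (h ^~ S).
  move=> z; apply: cvgB; first exact: cvg_id.
  apply: (@continuous_comp _ _ _ (fun w => S - w) r); last exact: rc.
  by apply: cvgB; [exact: cvg_cst|exact: cvg_id].
have hinc S z w : z < w -> h z S < h w S.
  move=> zw; have := rinc (S - w) (S - z); rewrite /h ltrD2l ltrN2 => /(_ zw).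
  by lra.
have /choice[x hx] : forall S, exists z, h z S = 0.
  move=> S; have [|||z _ hz] := @IVT R (h ^~ S) lo hi 0; last by exists z.
  - by have /andP[] := rb 0; exact: le_trans.
  - exact: continuous_subspaceT.
  - rewrite ge_min le_max /h !subr_le0 !subr_ge0.
    by have /andP[-> _] := rb (S - lo); have /andP[_ ->] := rb (S - hi);
      rewrite orbT.
have xE S z : z = r (S - z) <-> z = x S.
  have rx : x S = r (S - x S) by have /eqP := hx S; rewrite subr_eq0 => /eqP.
  split=> [rz|->//]; have hz : h z S = 0 by rewrite /h -rz subrr.
  by have [/(hinc S)|/(hinc S)|//] := ltgtP z (x S); rewrite hz hx ltxx.
exists x; split=> //; first exact: (continuous_root _ h).
move=> S T ST; rewrite leNgt; apply/negP => xST.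
have rS : x S = r (S - x S) by apply/xE.
have rT : x T = r (T - x T) by apply/xE.
(* Compare the opponents' sums: if theirs does not fall, [rdec] gives [x T <= x S]; if it falls,
   [rinc] gives [T < S]. *)
have [le_ST|/rinc] := leP (S - x S) (T - x T).
  by have := rdec _ _ le_ST; rewrite -rS -rT leNgt xST.
by rewrite -rS -rT !subrK ltNge ST.
Qed.

Lemma aggregative_fixpoint (R : realType) (N : nat)
    (r : 'I_N -> R -> R) (lo hi : 'I_N -> R) :
  (forall i, continuous (r i)) ->
  (forall i y, lo i <= r i y <= hi i) ->
  (forall i y z, y <= z -> r i z <= r i y) ->
  (forall i y z, y < z -> y + r i y < z + r i z) ->
  exists! b : 'rV[R]_N,
    forall i, b ord0 i = r i (\sum_(j < N) b ord0 j - b ord0 i).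
Proof.
move=> rc rb rdec rinc.
have /choice[x] i :=
  replacement_function _ _ _ _ (rc i) (rb i) (rdec i) (rinc i).
move=> /all_and3[xc xdec xE].
have x_bnd i S : lo i <= x i S <= hi i.
  by have -> : x i S = r i (S - x i S) by apply/xE.
pose F S := \sum_(i < N) x i S - S.
have Fc : continuous F.
  move=> S; apply: cvgB; last exact: cvg_id.
  by apply: cvg_big => [|i _]; [exact: add_continuous|exact: xc].
(* Since [x i] stays within [[lo i, hi i]], [F] is nonnegative at the sum of lower bounds and
   nonpositive at the sum of upper bounds. *)
have [|||S _ /eqP] := @IVT R F (\sum_i lo i) (\sum_i hi i) 0.
- by apply: ler_sum => i _; have /andP[] := x_bnd i 0; exact: le_trans.
- exact: continuous_subspaceT.
- rewrite ge_min le_max /F !subr_le0 !subr_ge0.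
  apply/andP; split; apply/orP; [right|left]; apply: ler_sum => i _.
    by have /andP[] := x_bnd i (\sum_i hi i).
  by have /andP[] := x_bnd i (\sum_i lo i).
rewrite subr_eq0 => /eqP sumx.
exists (\row_i x i S); split=> [i|b bE].
  under eq_bigr do rewrite mxE.
  by rewrite sumx !mxE; apply/xE.
pose T := \sum_j b ord0 j.
have bx i : b ord0 i = x i T by apply/xE/bE.
have sumT : \sum_i x i T = T by apply: eq_bigr => i _; rewrite bx.
suff ST : S = T by apply/rowP => i; rewrite mxE bx ST.
by have [ST|TS|//] := ltgtP S T; [have := ST|have := TS];
  rewrite -{1}sumx -{1}sumT ltNge ler_sum// => i _; apply: xdec; exact: ltW.
Qed.

(** * Strict quasiconcavity, uniqueness and continuity of the maximiser *)

(** If [z] beat neither end, mean values on both sides of [z] would give [c < d] with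
    [V1 c <= 0 <= V1 d], while [V2 < 0] forces [V1 d < V1 c]. *)
Lemma concave_strict_quasiconcave (R : realType) (V V1 V2 : R -> R) (lo hi : R)
  :
  (forall t, lo <= t <= hi -> is_derive t 1 V (V1 t)) ->
  (forall t, lo <= t <= hi -> is_derive t 1 V1 (V2 t)) ->
  (forall t, lo <= t <= hi -> V2 t < 0) ->
  forall x z w, lo <= x -> x < z < w -> w <= hi -> V x < V z \/ V w < V z.
Proof.
move=> dV dV1 V2_lt0 x z w lox /andP[xz zw] whi.
have mvt (g g' : R -> R) u v : (forall t, lo <= t <= hi -> is_derive t 1 g (g'
  t)) ->
    lo <= u -> u < v -> v <= hi ->
    exists2 c, u < c < v & g v - g u = g' c * (v - u).
  move=> dg lou uv vhi.
  have [t|t|c] := @MVT _ g g' u v uv.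
  - rewrite in_itv /= => /andP[ut tv]; apply: dg.
    by rewrite (le_trans lou (ltW ut)) (le_trans (ltW tv) vhi).
  - apply: derivable_within_continuous => s; rewrite in_itv /= => /andP[us sv].
    suff: is_derive s 1 g (g' s) by move=> ?; exact: ex_derive.
    by apply: dg; rewrite (le_trans lou us) (le_trans sv vhi).
  - by rewrite in_itv /= => cuv e; exists c.
have [ltx|lex] := ltP (V x) (V z); [by left|right].
rewrite ltNge; apply/negP => lew.
have zhi := le_trans (ltW zw) whi; have loz := le_trans lox (ltW xz).
have [c /andP[xc cz] ec] := mvt _ _ _ _ dV lox xz zhi.
have [d /andP[zd dw] ed] := mvt _ _ _ _ dV loz zw whi.
have V1c : V1 c <= 0.
  by rewrite -(@pmulr_lle0 _ (z - x)) ?subr_gt0// -ec subr_le0.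
have V1d : 0 <= V1 d.
  by rewrite -(@pmulr_lge0 _ (w - z)) ?subr_gt0// -ed subr_ge0.
have loc := le_trans lox (ltW xc); have dhi := le_trans (ltW dw) whi.
have cd := lt_trans cz zd.
have [s /andP[cs sd] es] := mvt _ _ _ _ dV1 loc cd dhi.
have : V1 d - V1 c < 0.
  rewrite es nmulr_rlt0 ?subr_gt0// V2_lt0//.
  by rewrite (le_trans loc (ltW cs)) (le_trans (ltW sd) dhi).
by lra.
Qed.

Section strict_quasiconcave_argmax.
Context (R : realType) (lo hi : R) (W : R -> R -> R) (r : R -> R).
Hypothesis Wc : forall x, lo <= x <= hi -> continuous (W x).
Hypothesis Wqc : forall y x z w, lo <= x -> x < z < w -> w <= hi ->
  W x y < W z y \/ W w y < W z y.
Hypothesis r_bnd : forall y, lo <= r y <= hi.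
Hypothesis r_max : forall y x, lo <= x <= hi -> W x y <= W (r y) y.

(** The midpoint of two distinct maximisers would be strictly better than one of them. *)
Lemma argmax_strict y x : lo <= x <= hi -> x != r y -> W x y < W (r y) y.
Proof.
move=> /[dup] xb /andP[lox xhi] xr; rewrite ltNge; apply/negP => le_rx.
have /andP[lor rhi] := r_bnd y.
have mid_max : W ((x + r y) / 2) y <= W (r y) y.
  by apply: r_max; apply/andP; split; lra.
have [xlt|rlt|/eqP] := ltgtP x (r y); last by rewrite (negPf xr).
- have [|//||] := Wqc y x ((x + r y) / 2) (r y) lox; last by lra.
    by apply/andP; split; lra.
  by lra.
- have [|//||] := Wqc y (r y) ((x + r y) / 2) x lor; last by lra.
    by apply/andP; split; lra.
  by lra.
Qed.

(** Continuity of [W] in the parameter alone suffices. For [u = r y0 + e] or [u = r y0 - e] within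
    bounds, [r y0] still beats [u] when [y] is near [y0]. Were [r y] at or beyond [u], then [u]
    would be optimal itself or, by quasiconcavity, strictly better than [r y0] or [r y]; each case
    is impossible. *)
Lemma argmax_continuous : continuous r.
Proof.
move=> y0; apply/cvgrPdist_lt => e e0; have /andP[lor rhi] := r_bnd y0.
have near_lt u : lo <= u <= hi -> u != r y0 ->
    \forall y \near y0, W u y < W (r y0) y.
  move=> ub /argmax_strict - /(_ ub); rewrite -subr_gt0 => W_gt0.
  have Wdc : {for y0, continuous (fun y => W (r y0) y - W u y)}.
    by apply: cvgB; exact: Wc.
  near=> y; rewrite -subr_gt0; near: y.
  exact: (cvgr_gt _ Wdc _ W_gt0).
have above : \forall y \near y0, r y < r y0 + e.
  have [hu|uhi] := ltP hi (r y0 + e).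
    by near=> y; have /andP[_ /le_lt_trans] := r_bnd y; apply.
  have ub : lo <= r y0 + e <= hi by rewrite uhi andbT; lra.
  have un : r y0 + e != r y0 by rewrite gt_eqF// ltrDl.
  apply: filterS (near_lt _ ub un) => y Wlt; rewrite ltNge; apply/negP.
  rewrite le_eqVlt => /predU1P[eu|ult].
    by have := r_max y (r y0) (r_bnd y0); rewrite -eu leNgt Wlt.
  have /andP[_ ryhi] := r_bnd y.
  have [||] := Wqc y (r y0) (r y0 + e) (r y) lor _ ryhi.
  - by rewrite ltrDl e0.
  - by rewrite ltNge (ltW Wlt).
  - by rewrite ltNge r_max.
have below : \forall y \near y0, r y0 - e < r y.
  have [hu|ulo] := ltP (r y0 - e) lo.
    by near=> y; have /andP[/(lt_le_trans hu)] := r_bnd y.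
  have ub : lo <= r y0 - e <= hi by rewrite ulo /=; lra.
  have un : r y0 - e != r y0 by rewrite lt_eqF// ltrBlDr ltrDl.
  apply: filterS (near_lt _ ub un) => y Wlt; rewrite ltNge; apply/negP.
  rewrite le_eqVlt => /predU1P[eu|ult].
    by have := r_max y (r y0) (r_bnd y0); rewrite eu leNgt Wlt.
  have /andP[lory _] := r_bnd y.
  have [||] := Wqc y (r y) (r y0 - e) (r y0) lory _ rhi.
  - by rewrite ult ltrBlDr ltrDl.
  - by rewrite ltNge r_max.
  - by rewrite ltNge (ltW Wlt).
near=> y; rewrite ltr_norml.
have u : r y < r y0 + e by near: y.
have v : r y0 - e < r y by near: y.
by apply/andP; split; lra.
Unshelve. all: by end_near. Qed.

End strict_quasiconcave_argmax.

(** * Difference quotients and one-coordinate updates *)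

Lemma derive1_neq0_derivable (R : realType) (f : R -> R) (a : R) :
  derive1 f a != 0 -> derivable f a 1.
Proof. by rewrite derive1E; exact: cvgNpoint. Qed.

(** The difference quotients agree near [0], so their limits agree even by default value; no
    differentiability is assumed. *)
Lemma near_shift_derive1 (R : realType) (f g : R -> R) (a c : R) :
  (\forall h \near (0 : R), f (h + a) = g (h + c)) ->
  derive1 f a = derive1 g c.
Proof.
move=> fg; have /= := nbhs_singleton fg; rewrite !add0r => fgac.
have quot_eq : \forall h \near 0^',
    h^-1 *: (f (h + a) - f a) = h^-1 *: (g (h + c) - g c).
  by apply: nbhs_dnbhs; apply: filterS fg => h ->; rewrite fgac.
rewrite /derive1; congr (lim _); apply/seteqP.
by split; apply: near_eq_cvg => //; apply: filterS quot_eq => h.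
Qed.

Lemma upd_id (R : realType) (N : nat) (b : 'rV[R]_N) (i : 'I_N) :
  upd b i (b ord0 i) = b.
Proof. by apply/rowP => k; rewrite mxE; case: eqP => [->|]. Qed.

Lemma updD (R : realType) (N : nat) (b : 'rV[R]_N) (i : 'I_N) (x h : R) :
  upd b i (h + x) = h *: delta_mx ord0 i + upd b i x.
Proof.
apply/rowP => k; rewrite !mxE eqxx /=.
by case: (k == i); rewrite ?mulr1 ?mulr0 ?add0r.
Qed.

Lemma updDZ (R : realType) (N : nat) (b d : 'rV[R]_N) (i : 'I_N) (s x : R) :
  upd (b + s *: d) i x = upd b i x + s *: upd d i 0.
Proof.
by apply/rowP => k; rewrite !mxE; case: (k == i); rewrite ?mulr0 ?addr0.
Qed.

Lemma is_derive_upd (R : realType) (N : nat) (F : 'rV[R]_N -> R)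
    (b : 'rV[R]_N) (i : 'I_N) (t : R) :
  has_partial i F (upd b i t) ->
  is_derive t 1 (fun s => F (upd b i s)) (partial i F (upd b i t)).
Proof.
have quotE : (fun h : R => h^-1 *: (((fun s => F (upd b i s)) \o shift t) (h *:
  1)
      - F (upd b i t))) =
    (fun h : R => h^-1 *: ((F \o shift (upd b i t)) (h *: delta_mx ord0 i)
      - F (upd b i t))).
  by apply/funext => h; rewrite /= [h *: 1]mulr1 updD.
move=> Fi; split; first by rewrite /derivable quotE.
by rewrite /derive quotE.
Qed.

(** * Best responses as functions of the opponents' sum *)

Section pooling_game.
Context {R : realType} {N : nat} (G : pooling_game R N).
Implicit Types (b c : 'rV[R]_N) (i j : 'I_N).

Lemma profile_upd b i x :
  profile G b -> bmin G i <= x <= bmax G i -> profile G (upd b i x).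
Proof. by move=> Gb xb k; rewrite mxE; case: eqP => [->|]. Qed.

Lemma utility_own_derive b i t : profile G b -> bmin G i <= t <= bmax G i ->
  is_derive t 1 (fun s => utility G i (upd b i s))
    (partial i (utility G i) (upd b i t)) /\
  is_derive t 1 (fun s => partial i (utility G i) (upd b i s))
    (partial i (partial i (utility G i)) (upd b i t)).
Proof.
move=> Gb tb; have [D [_ boxD smooth]] := utility_C2 G i.
have [_ D1 D2] := smooth _ (boxD _ (profile_upd _ _ _ Gb tb)).
by split; apply: is_derive_upd; [case: (D1 i)|case: (D2 i i)].
Qed.

Lemma utility_continuous b i : profile G b -> {for b, continuous (utility G i)}.
Proof.
by have [D [_ boxD smooth]] := utility_C2 G i; move=> /boxD /smooth[].
Qed.

Lemma utility_own_quasiconcave b i x z w : profile G b ->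
  bmin G i <= x -> x < z < w -> w <= bmax G i ->
  utility G i (upd b i x) < utility G i (upd b i z) \/
  utility G i (upd b i w) < utility G i (upd b i z).
Proof.
move=> Gb; apply: (@concave_strict_quasiconcave _
  (fun t => utility G i (upd b i t))
  (fun t => partial i (utility G i) (upd b i t))
  (fun t => partial i (partial i (utility G i)) (upd b i t))) => t tb.
- by have [] := utility_own_derive _ _ _ Gb tb.
- by have [] := utility_own_derive _ _ _ Gb tb.
- exact/utility_concave/profile_upd.
Qed.

Lemma BR_argmax b i : profile G b -> argmax_set G i b (BR G i b).
Proof.
move=> Gb; apply: getPex.
have [|x xb xmax] := @EVT_max _ (fun t => utility G i (upd b i t)) _ _
  (bmin_le_bmax G i).
  apply: derivable_within_continuous => t; rewrite in_itv /= => tb.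
  by have [? _] := utility_own_derive _ _ _ Gb tb; exact: ex_derive.
by rewrite in_itv in xb; exists x; split=> // y yb; apply: xmax; rewrite in_itv.
Qed.

Lemma argmax_BR b i x : profile G b -> argmax_set G i b x -> x = BR G i b.
Proof.
move=> Gb [xb xmax]; have [rb rmax] := BR_argmax _ i Gb.
apply/eqP; apply: contraT => xr.
(* The objective ignores its parameter, so [0] is an arbitrary choice. *)
have /= := @argmax_strict _ (bmin G i) (bmax G i)
  (fun x (_ : R) => utility G i (upd b i x)) (fun=> BR G i b) _ _ _ 0 x xb xr.
rewrite ltNge xmax//; apply=> //.
by move=> _ u z w; apply: utility_own_quasiconcave.
Qed.

Lemma sum_upd_other b i x :
  \sum_(j < N | j != i) upd b i x ord0 j = \sum_(j < N | j != i) b ord0 j.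
Proof. by apply: eq_bigr => j /negPf ji; rewrite mxE ji. Qed.

(** By aggregativity both profiles give player [i] the same payoff curve in the own strategy, and
    its maximiser is unique. *)
Lemma eq_BR b c i : profile G b -> profile G c ->
  \sum_(j < N | j != i) b ord0 j = \sum_(j < N | j != i) c ord0 j ->
  BR G i b = BR G i c.
Proof.
move=> Gb Gc bc; have [rb rmax] := BR_argmax _ i Gb.
have uE x : bmin G i <= x <= bmax G i ->
    utility G i (upd b i x) = utility G i (upd c i x).
  move=> xb; apply: utility_aggregative; do ?exact: profile_upd.
    by rewrite !mxE eqxx.
  by rewrite !sum_upd_other.
by apply: argmax_BR => //; split=> // y yb; rewrite -!uE// rmax.
Qed.

Definition others_min i : R := \sum_(j < N | j != i) bmin G j.
Definition others_max i : R := \sum_(j < N | j != i) bmax G j.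

(** Clamping extends reactions constantly beyond the attainable sums, because the fixed-point
    argument needs functions on the whole line. *)
Definition clamp i (y : R) : R :=
  Num.max (others_min i) (Num.min (others_max i) y).

Definition clamp_frac i y : R :=
  (clamp i y - others_min i) / (others_max i - others_min i).

(* A profile in which the opponents of [i] have sum [y] once [y] is clamped to
   the attainable sums. If only one sum is attainable, [clamp_frac] is the junk
   value [0 / 0 = 0], which is harmless: each opponent has one strategy. *)
Definition spread i y : 'rV[R]_N :=
  \row_k bmin G k + clamp_frac i y *: \row_k (bmax G k - bmin G k).

(** This is [r_i] of the opening sketch; by [BR_reaction] the particular choice of opponents'
    profile is immaterial. *)
Definition reaction i y : R := BR G i (spread i y).

Lemma others_min_le_max i : others_min i <= others_max i.
Proof. by apply: ler_sum => j _; exact: bmin_le_bmax. Qed.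

Lemma clamp_bnd i y : others_min i <= clamp i y <= others_max i.
Proof.
by rewrite /clamp le_max lexx ge_max others_min_le_max /= ge_min lexx.
Qed.

Lemma clamp_id i y : others_min i <= y <= others_max i -> clamp i y = y.
Proof. by case/andP => oy yo; rewrite /clamp (min_idPr yo) (max_idPr oy). Qed.

Lemma clamp_le i y z : y <= z -> clamp i y <= clamp i z.
Proof.
move=> yz; rewrite /clamp ge_max !le_max lexx /= le_min !ge_min lexx yz.
by rewrite !orbT.
Qed.

Lemma clamp_lipschitz i y z : y <= z -> clamp i z - clamp i y <= z - y.
Proof.
rewrite /clamp; move: (others_min i) (others_max i) (others_min_le_max i) => o
  m om yz.
by case: (leP m y); case: (leP m z); case: (leP o y); case: (leP o z);
  case: (leP o m) => ?????; lra.
Qed.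

Lemma clamp_frac_bnd i y : 0 <= clamp_frac i y <= 1.
Proof.
have /andP[c1 c2] := clamp_bnd i y; rewrite /clamp_frac.
have [e|ne] := eqVneq (others_max i - others_min i) 0;
  first by rewrite e invr0 mulr0 lexx ler01.
have D0 : 0 < others_max i - others_min i by rewrite lt_neqAle eq_sym ne
  subr_ge0 others_min_le_max.
by rewrite divr_ge0 ?subr_ge0 ?others_min_le_max//= ler_pdivrMr// mul1r lerD2r.
Qed.

Lemma spread_profile i y : profile G (spread i y).
Proof.
move=> k; rewrite !mxE; have /andP[f0 f1] := clamp_frac_bnd i y.
have wk : 0 <= bmax G k - bmin G k by rewrite subr_ge0 bmin_le_bmax.
rewrite lerDl mulr_ge0//= -lerBrDl.
by rewrite -[leRHS]mul1r ler_wpM2r.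
Qed.

Lemma sum_spread i y : others_min i <= y <= others_max i ->
  \sum_(j < N | j != i) spread i y ord0 j = y.
Proof.
move=> /[dup] yb /clamp_id cy.
under eq_bigr do rewrite !mxE.
rewrite big_split /= -mulr_sumr sumrB -/(others_min i) -/(others_max i)
  /clamp_frac cy.
(* If only one sum is attainable, [y] is squeezed between equal bounds. *)
have [e|ne] := eqVneq (others_max i - others_min i) 0;
  last by rewrite divfK// subrKC.
have /andP[y1 y2] := yb.
by rewrite e mulr0 addr0; apply/eqP;
  rewrite eq_le y1 (le_trans y2)// -subr_le0 e.
Qed.

Lemma reaction_clamp i y : reaction i (clamp i y) = reaction i y.
Proof.
by rewrite /reaction /spread /clamp_frac (clamp_id _ (clamp i y)) ?clamp_bnd.
Qed.

Lemma sum_other_bnd b i : profile G b ->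
  others_min i <= \sum_(j < N | j != i) b ord0 j <= others_max i.
Proof.
by move=> Gb; apply/andP; split; apply: ler_sum => j _; have /andP[] := Gb j.
Qed.

Lemma BR_reaction b i : profile G b ->
  BR G i b = reaction i (\sum_(j < N | j != i) b ord0 j).
Proof.
move=> Gb; apply: eq_BR => //; first exact: spread_profile.
by rewrite sum_spread// sum_other_bnd.
Qed.

Lemma reaction_bnd i y : bmin G i <= reaction i y <= bmax G i.
Proof. by have [] := BR_argmax _ i (spread_profile i y). Qed.

Lemma clamp_frac_continuous i : continuous (clamp_frac i).
Proof.
move=> y; apply: cvgMl; apply: cvgB; last exact: cvg_cst.
apply: (@continuous_max _ _ (cst (others_min i))); first exact: cvg_cst.
by apply: (@continuous_min _ _ (cst (others_max i)));
  [exact: cvg_cst|exact: cvg_id].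
Qed.

Lemma reaction_continuous i : continuous (reaction i).
Proof.
apply: (@argmax_continuous _ (bmin G i) (bmax G i)
  (fun x y => utility G i (upd (spread i y) i x))).
- move=> x xb y.
  apply: (@continuous_comp _ _ _ (fun y => upd (spread i y) i x)); last first.
    by apply/utility_continuous/profile_upd => //; exact: spread_profile.
  (* The path of profiles is affine in [clamp_frac i y]; its direction has [i]-th entry [0], which
     keeps the own strategy at [x]. *)
  have -> : (fun y => upd (spread i y) i x) =
      (fun y => 
        upd (\row_k bmin G k) i x
        + clamp_frac i y *: upd (\row_k (bmax G k - bmin G k)) i 0).
    by apply/funext => z; rewrite /spread updDZ.
  apply: cvgD; first exact: cvg_cst.
  by apply: cvgZr_tmp; exact: clamp_frac_continuous.
- by move=> y x z w; apply: utility_own_quasiconcave; exact: spread_profile.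
- exact: reaction_bnd.
- by move=> y x xb; have [_] := BR_argmax _ i (spread_profile i y); apply.
Qed.

Lemma nash_reaction b : nash_equilibrium G b <->
  forall i, b ord0 i = reaction i (\sum_(j < N) b ord0 j - b ord0 i).
Proof.
have sumE i : \sum_(j < N) b ord0 j - b ord0 i = \sum_(j < N | j != i) b ord0 j.
  by rewrite (bigD1 i)//= addrAC subrr add0r.
split=> [[Gb Nb] i|bE].
  rewrite sumE -BR_reaction//; apply: argmax_BR => //; split; first exact: Gb.
  by move=> y yb; rewrite upd_id Nb.
(* Reactions take values in the strategy intervals, so a fixed point is automatically a profile. *)
have Gb : profile G b by move=> i; rewrite bE reaction_bnd.
split=> // i x xb; have [_] := BR_argmax _ i Gb.
by rewrite BR_reaction// -sumE -bE upd_id; apply.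
Qed.

(** Moving a single opponent [j] by [h] moves the opponents' sum by [h], so the slope of the
    reaction is [J_BR G i j] at the spread profile, provided [j] lies strictly inside a
    nondegenerate interval. *)
Lemma reaction_slope (i : 'I_N) (y : R) :
  (forall j b, j != i -> profile G b -> slope_defined G i j b ->
    -1 < J_BR G i j b < 0) ->
  others_min i < y < others_max i -> bmin G i < reaction i y < bmax G i ->
  derivable (reaction i) y 1 /\ -1 < derive1 (reaction i) y < 0.
Proof.
move=> HJ /andP[oy yo] ry.
have yb : others_min i <= y <= others_max i by rewrite !ltW.
have D0 : 0 < others_max i - others_min i by lra.
(* If every opponent's interval were a point, only one sum would be attainable. *)
have [j ji jlt] : exists2 j, j != i & bmin G j < bmax G j.
  apply/not_exists2P => no; suff : others_max i <= others_min i by lra.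
  apply: ler_sum => j ji; rewrite leNgt; apply/negP => jlt.
  by case: (no j) => /=.
pose b := spread i y; have Gb : profile G b by exact: spread_profile.
have f0 : 0 < clamp_frac i y by rewrite divr_gt0// clamp_id// subr_gt0.
have f1 : clamp_frac i y < 1 by rewrite ltr_pdivrMr// mul1r clamp_id// ltrD2r.
have bj : bmin G j < b ord0 j < bmax G j.
  rewrite !mxE; have wj : 0 < bmax G j - bmin G j by rewrite subr_gt0.
  by rewrite ltrDl mulr_gt0//= -ltrBrDl gtr_pMl.
(* [ry] is the second half of [slope_defined], since [BR G i b] is [reaction i y] by definition. *)
have /andP[J1 J0] := HJ j b ji Gb (conj bj ry).
have near_reaction : \forall h \near (0 : R),
    BR G i (upd b j (h + b ord0 j)) = reaction i (h + y).
  have /andP[b1 b2] := bj.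
  near=> h.
  have Gh : profile G (upd b j (h + b ord0 j)).
    apply: profile_upd => //; rewrite -[X in X && _]lerBlDr -[X in _ &&
      X]lerBrDr.
    apply/andP; split; near: h.
      by apply: lt_le_nbhsr; lra.
    by apply: lt_le_nbhsl; lra.
  rewrite BR_reaction//; congr (reaction _ _).
  rewrite -[in RHS](sum_spread i y)// (bigD1 j)//= [in RHS](bigD1 j)//= addrA.
  rewrite mxE eqxx; congr (_ + _).
  by apply: eq_bigr => k /andP[_ /negPf kj]; rewrite mxE kj.
rewrite /J_BR (near_shift_derive1 _ (fun t => BR G i (upd b j t)) _ _ _
  near_reaction) in J1 J0.
by split; [apply: derive1_neq0_derivable; rewrite lt_eqF|rewrite J1].
Unshelve. all: by end_near. Qed.

End pooling_game.

(** * Existence and uniqueness of the equilibrium *)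

Theorem proposition6 (R : realType) (N : nat) (G : pooling_game R N)
  (HJ : forall (i j : 'I_N) (b : 'rV[R]_N), j != i -> profile G b ->
     slope_defined G i j b -> -1 < J_BR G i j b < 0) :
  exists! b : 'rV[R]_N, nash_equilibrium G b.
Proof.
have slope i y := reaction_slope G i y (HJ i).
have rdec i y z : y <= z -> reaction G i z <= reaction G i y.
  (* The slope bounds hold only between the extreme sums, so both arguments are first clamped into
     that range. *)
  move=> yz; rewrite -(reaction_clamp G i y) -(reaction_clamp G i z).
  have /andP[y1 _] := clamp_bnd G i y; have /andP[_ z2] := clamp_bnd G i z.
  apply: (clamped_slope_nonincreasing _ _ _ _ _ _ (reaction_continuous G i)
    (reaction_bnd G i) (slope i)) => //.
  exact: clamp_le.
have rinc i y z : y < z -> y + reaction G i y < z + reaction G i z.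
  move=> yz; rewrite -(reaction_clamp G i y) -(reaction_clamp G i z).
  have /andP[y1 _] := clamp_bnd G i y; have /andP[_ z2] := clamp_bnd G i z.
  have lip := clamp_lipschitz G i _ _ (ltW yz).
  (* If the clamped sums coincide, so do the reactions. Otherwise the reaction drops by less than
     the clamped increment, which is at most [z - y] by [lip]. *)
  have := clamp_le G i _ _ (ltW yz); rewrite le_eqVlt => /predU1P[->|clt].
    by rewrite ltrD2r.
  have := clamped_slope_increasing _ _ _ _ _ _ (reaction_continuous G i)
    (reaction_bnd G i) (slope i) _ _ y1 clt z2.
  by lra.
have [b [bE buniq]] := aggregative_fixpoint _ _ _ _ _
  (reaction_continuous G) (reaction_bnd G) rdec rinc.
exists b; split=> [|c /nash_reaction cE]; first exact/nash_reaction.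
exact: buniq.
Qed.
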